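(* Let $G$ be a connected balanced bipartite graph. Then $G$ admits a $1$-sum $\mathbb{R}^*$-flow if and only if for every cut edge $e$ of $G$, no connected component of $G-e$ is a balanced bipartite graph.
   Context: $\mathbb{R}^*=\mathbb{R}\setminus\{0\}$. For a graph $G=(V,E)$ and $L\subseteq\mathbb{R}$, a $1$-sum $L$-flow is a function $\omega:E\to L$ such that $\sum_{e\ni v}\omega(e)=1$ for every vertex $v$. A bipartite graph is balanced if its two parts have equal size. A cut edge is an edge whose removal increases the number of connected components. *)

(* Defs.v *)
From HB Require Import structures.
From mathcomp Require Import all_boot all_order all_algebra.
From mathcomp Require Import classical_sets reals.

Set Implicit Arguments.
Unset Strict Implicit.
Unset Printing Implicit Defensive.

Import Order.TTheory GRing.Theory Num.Theory.
Local Open Scope ring_scope.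

Record sgraph := SGraph {
  vertex :> finType;
  adj : rel vertex;
  adj_sym : symmetric adj;
  adj_irr : irreflexive adj
}.

(* An edge is the unordered pair of its two endpoints. *)
Definition edges (G : sgraph) : {set {set G}} :=
  [set [set p.1; p.2] | p : G * G & adj p.1 p.2].

(* Vertex sets of the connected components. *)
Definition components (G : sgraph) : {set {set G}} :=
  equivalence_partition (connect (@adj G)) [set: G].

(* This excludes the graph with no vertex. *)
Definition graph_connected (G : sgraph) : Prop := #|components G| = 1%N.

Definition del_rel (G : sgraph) (e : {set G}) : rel G :=
  fun x y => adj x y && ([set x; y] != e).

Lemma del_rel_sym (G : sgraph) (e : {set G}) : symmetric (del_rel e).
Proof. by move=> x y; rewrite /del_rel adj_sym finset.setUC. Qed.

Lemma del_rel_irr (G : sgraph) (e : {set G}) : irreflexive (del_rel e).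
Proof. by move=> x; rewrite /del_rel adj_irr. Qed.

Definition del_edge (G : sgraph) (e : {set G}) : sgraph :=
  SGraph (del_rel_sym e) (del_rel_irr e).

Definition induced_rel (G : sgraph) (S : {set G}) : rel {x : G | x \in S} :=
  fun x y => adj (val x) (val y).

Lemma induced_rel_sym (G : sgraph) (S : {set G}) : symmetric (@induced_rel G S).
Proof. by move=> x y; exact: adj_sym. Qed.

Lemma induced_rel_irr (G : sgraph) (S : {set G}) :
  irreflexive (@induced_rel G S).
Proof. by move=> x; exact: adj_irr. Qed.

Definition induced (G : sgraph) (S : {set G}) : sgraph :=
  SGraph (@induced_rel_sym G S) (@induced_rel_irr G S).

Definition cut_edge (G : sgraph) (e : {set G}) : Prop :=
  e \in edges G /\ (#|components G| < #|components (del_edge e)|)%N.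

Definition bipartition (G : sgraph) (A B : {set G}) : Prop :=
  [/\ A :|: B = [set: G], [disjoint A & B] &
      forall x y : G, adj x y ->
        (x \in A /\ y \in B) \/ (x \in B /\ y \in A)].

(* The two parts of a connected bipartite graph are unique up to exchange, so
   for connected graphs the choice of bipartition is immaterial. *)
Definition balanced_bipartite (G : sgraph) : Prop :=
  exists A B : {set G}, bipartition A B /\ #|A| = #|B|.

(* The values of omega outside edges G are irrelevant. *)
Definition one_sum_flow (R : realType) (G : sgraph) (L : set R)
    (omega : {set G} -> R) : Prop :=
  (forall e, e \in edges G -> L (omega e)) /\
  (forall v : G, \sum_(e in edges G | v \in e) omega e = 1).

Definition nonzero_reals (R : realType) : set R := [set x | x != 0]%classic.

(* Main.v *)
(** Double counting pairs a flow [omega] with a vertex weight [s]: the sum of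
    [s] over all vertices is the sum over the edges [xy] of
    [omega xy * (s x + s y)].

    If a component [C] of [G - e] is balanced, let [s] be [1] on one part of
    [C], [-1] on the other and [0] outside [C]. Then [s x + s y = 0] on every
    edge other than [e], which has exactly one end in [C], so [omega e = 0].

    Conversely, by the Fredholm alternative, a flow with a prescribed value [c]
    on [e] can fail to exist only because of a weight [s] with [s x + s y = 0]
    on all edges but [e]. Changing the sign of [s] on one part of [G] gives a
    function that is constant on the components of [G - e]. If [e] is not a cut
    edge, this rules out any obstruction; if it is, the only possible value is
    the imbalance [c = |A :&: C| - |B :&: C|] of a component [C], which is
    nonzero by hypothesis. A generic affine combination of the flows obtained
    for the various [e] vanishes nowhere. *)
Require Import Defs.
From HB Require Import structures.
From mathcomp Require Import all_boot all_order all_algebra.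
From mathcomp Require Import classical_sets reals.
From mathcomp Require Import ring.

Set Implicit Arguments.
Unset Strict Implicit.
Unset Printing Implicit Defensive.

Import Order.TTheory GRing.Theory Num.Theory.
Local Open Scope ring_scope.

(** * Linear systems over finite index types and generic points of affine families *)

Lemma sum_enum_val (V : nmodType) (I : finType) (F : I -> V) :
  \sum_i F i = \sum_(k < #|I|) F (enum_val k).
Proof. exact/reindex/onW_bij/enum_val_bij. Qed.

(** A row vector lies in the row space of a matrix exactly when the cokernel matrix kills it, and
    the columns of that matrix are homogeneous solutions [y]. *)
Lemma fredholm_alternative (F : fieldType) (I J : finType)
    (a : I -> J -> F) (b : J -> F) :
  (forall y : J -> F, (forall i, \sum_j a i j * y j = 0) ->
     \sum_j b j * y j = 0) ->
  exists x : I -> F, forall j, \sum_i x i * a i j = b j.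
Proof.
move=> ab0.
pose M := \matrix_(i < #|I|, j < #|J|) a (enum_val i) (enum_val j).
pose r := \row_(j < #|J|) b (enum_val j).
have /submxP[x rE] : (r <= M)%MS.
  rewrite submxE; apply/eqP/rowP=> k; rewrite !mxE.
  under eq_bigr do rewrite mxE.
  pose y j := cokermx M (enum_rank j) k.
  have := ab0 y; rewrite sum_enum_val => yP.
  rewrite -[RHS]yP; first by apply: eq_bigr => j _; rewrite /y enum_valK.
  move=> i; have /matrixP/(_ (enum_rank i) k) := mulmx_coker M.
  rewrite !mxE => Mi0; rewrite -[RHS]Mi0 [LHS]sum_enum_val.
  by apply: eq_bigr => j _; rewrite /y enum_valK [M _ _]mxE enum_rankK.
exists (fun i => x 0 (enum_rank i)) => j.
have /rowP/(_ (enum_rank j)) := rE; rewrite !mxE enum_rankK => ->.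
rewrite [LHS]sum_enum_val.
by apply: eq_bigr => i _; rewrite enum_valK mxE enum_rankK.
Qed.

(** Induction on [r]: on the line through a member good on the tail and a member good at the head,
    each coordinate that varies vanishes for a single parameter, so a large parameter avoids them
    all. *)
Lemma generic_affine_combination (R : realFieldType) (I : eqType) (r : seq I)
    (P : (I -> R) -> Prop) :
  (forall t f g, P f -> P g -> P (fun i => f i + t * (g i - f i))) ->
  (exists f, P f) ->
  (forall i, i \in r -> exists2 f, P f & f i != 0) ->
  exists2 f, P f & forall i, i \in r -> f i != 0.
Proof.
move=> Paff [f0 Pf0]; elim: r => [|e r IHr] nz; first by exists f0.
have [f Pf fr] : exists2 f, P f & forall i, i \in r -> f i != 0.
  by apply: IHr => i ir; apply: nz; rewrite inE ir orbT.
have [g Pg ge] := nz e (mem_head _ _).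
(* The parameter at which coordinate [i] vanishes when [f i != g i]; otherwise division by zero
   makes it the harmless value 0. The [1 +] in [t] makes the bound strict. *)
pose bad i := - f i / (g i - f i).
pose t := 1 + \sum_(i <- e :: r) `|bad i|.
exists (fun i => f i + t * (g i - f i)); first exact: Paff.
move=> i ir; have [d0|d0] := eqVneq (g i - f i) 0.
  rewrite d0 mulr0 addr0; move: ir; rewrite inE => /orP[/eqP ie|/fr//].
  by move/eqP: d0; rewrite subr_eq0 ie => /eqP <-.
apply/eqP => eq0.
have tE : t = bad i.
  by apply: (mulIf d0); rewrite /bad mulfVK //; apply/eqP;
    rewrite -subr_eq0 opprK addrC eq0.
have : bad i < t.
  rewrite /t (perm_big _ (perm_to_rem ir)) big_cons /=.
  apply: le_lt_trans (ler_norm _) _; rewrite addrCA ltrDl.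
  by rewrite ltr_pwDl // sumr_ge0.
by rewrite tE ltxx.
Qed.

(** * Edges, components and cut edges *)

Section Graph.

Variable G : sgraph.
Implicit Types (x y u v : G) (e f : {set G}).

Lemma edgesP f :
  reflect (exists x y, adj x y /\ f = [set x; y]) (f \in edges G).
Proof.
apply: (iffP imsetP) => [[[x y] xy ->]|[x [y [xy ->]]]].
  by exists x, y; split; first by rewrite inE in xy.
by exists (x, y); first by rewrite inE.
Qed.

Lemma sum_edge (V : nmodType) x y (s : G -> V) :
  adj x y -> \sum_(v in [set x; y]) s v = s x + s y.
Proof.
move=> xy; rewrite big_setU1 ?big_set1 // inE.
by apply: contraTneq xy => ->; rewrite adj_irr.
Qed.

Lemma flow_double_count (R : pzSemiRingType) (omega : {set G} -> R)
    (s : G -> R) :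
  \sum_v (\sum_(f in edges G | v \in f) omega f) * s v =
  \sum_(f in edges G) omega f * \sum_(v in f) s v.
Proof.
under eq_bigr do rewrite big_distrl.
rewrite (exchange_big_dep (mem (edges G))) /=; last by move=> v f _ /andP[].
apply: eq_bigr => f fE; rewrite big_distrr /=.
by apply: eq_bigl => v; rewrite fE.
Qed.

Lemma mem_component (H : sgraph) (C : {set H}) :
  reflect (exists x : H, C = [set y : H | connect (@adj H) x y])
    (C \in components H).
Proof.
apply: (iffP imsetP) => [[x _ ->]|[x ->]]; exists x => //;
  by apply/setP => y; rewrite !inE.
Qed.

Lemma graph_connectedP (x y : G) : graph_connected G -> connect (@adj G) x y.
Proof.
move=> /eqP/cards1P[C compE].
have inC z : [set w | connect (@adj G) z w] = C.
  by apply/set1P; rewrite -compE; apply/mem_component; exists z.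
have : y \in [set w | connect (@adj G) x w].
  by rewrite (inC x) -(inC y) inE connect0.
by rewrite inE.
Qed.

Lemma connect_del_sym e : connect_sym (@adj (del_edge e)).
Proof. exact/sym_connect_sym/adj_sym. Qed.

Lemma component_adj e (C : {set G}) x y :
  C \in components (del_edge e) -> adj x y -> [set x; y] != e ->
  (x \in C) = (y \in C).
Proof.
move=> /mem_component[z ->] xy xye; rewrite !inE.
have xy' : connect (@adj (del_edge e)) x y.
  by apply: connect1; rewrite /= /del_rel xy.
by rewrite (same_connect_r (@connect_del_sym e) xy').
Qed.

(** Follow a walk from [u]: whenever it crosses the deleted edge it lands on [u] or [v], and the
    count restarts there. *)
Lemma connect_del_edge u v x :
  connect (@adj G) u x ->
  connect (del_rel [set u; v]) u x \/ connect (del_rel [set u; v]) v x.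
Proof.
pose e := [set u; v].
suff H : forall p y, (connect (del_rel e) u y \/ connect (del_rel e) v y) ->
    path (@adj G) y p ->
    connect (del_rel e) u (last y p) \/ connect (del_rel e) v (last y p).
  by case/connectP=> p pth ->; apply: H => //; left; exact: connect0.
elim=> [//|z p IHp] y uvy /= /andP[yz]; apply: IHp.
have [yze|yze] := eqVneq [set y; z] e.
  have : z \in e by rewrite -yze !inE eqxx orbT.
  by rewrite !inE => /orP[] /eqP ->; [left|right]; exact: connect0.
have yz' : connect (del_rel e) y z by apply: connect1; rewrite /del_rel yz.
by case: uvy => H; [left|right]; exact: connect_trans yz'.
Qed.

Lemma cut_edge_separated u v x y :
  graph_connected G -> adj u v -> ~~ connect (del_rel [set u; v]) x y ->
  cut_edge [set u; v].
Proof.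
move=> Gconn uv nxy; split; first by apply/edgesP; exists u, v.
rewrite Gconn; set e := [set u; v].
pose D z : {set G} := [set w | connect (del_rel e) z w].
have DC z : D z \in components (del_edge e) by apply/mem_component; exists z.
apply/card_gt1P; exists (D x), (D y); split=> //.
apply: contraNneq nxy => /setP/(_ y).
by rewrite !inE connect0 => /esym.
Qed.

(** With both ends of [e] on the same side, [C] would be closed under adjacency in [G], hence be all
    of [G], and [G - e] would have a single component. *)
Lemma cut_edge_component e (C : {set G}) u v :
  graph_connected G -> cut_edge e -> C \in components (del_edge e) ->
  e = [set u; v] -> (u \in C) != (v \in C).
Proof.
move=> Gconn [_]; rewrite Gconn => cut CC eE; apply/eqP => uvC.
have closedC x y : adj x y -> (x \in C) = (y \in C).
  move=> xy; have [xye|] := eqVneq [set x; y] e; last exact: component_adj.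
  have : (x \in [set u; v]) && (y \in [set u; v]).
    by rewrite -eE -xye !inE !eqxx orbT.
  by rewrite !inE => /andP[/orP[]/eqP-> /orP[]/eqP->].
have /mem_component[z CE] := CC.
have zC y : connect (del_rel e) z y.
  have : y \in C.
    rewrite -(closed_connect closedC (graph_connectedP z y Gconn)) CE inE.
    exact: connect0.
  by rewrite CE inE.
suff : (#|components (del_edge e)| <= 1)%N by rewrite leqNgt cut.
apply/card_le1_eqP => D1 D2 /mem_component[z1 ->] /mem_component[z2 ->].
apply/setP => y; rewrite !inE /=.
have con w : connect (del_rel e) w y.
  by apply: connect_trans (zC y); rewrite connect_del_sym; exact: zC.
by rewrite !con.
Qed.

(** * Necessity: a balanced component forces the value zero *)

Lemma flow_not_balanced (R : numDomainType) (omega : {set G} -> R) e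
    (C : {set G}) :
  graph_connected G ->
  (forall v, \sum_(f in edges G | v \in f) omega f = 1) ->
  cut_edge e -> C \in components (del_edge e) ->
  balanced_bipartite (@induced (del_edge e) C) -> omega e = 0.
Proof.
move=> Gconn flow cut CC [A [B [[ABT ABdis ABadj] cAB]]].
pose A' : {set G} := [set val x | x in A].
pose B' : {set G} := [set val x | x in B].
(* [A'] and [B'] are the parts of [C] seen in [G], so [s] is 1 or -1 on [C] and 0 elsewhere. *)
pose s x : R := (x \in A')%:R - (x \in B')%:R.
have sum_s : \sum_x s x = 0.
  rewrite sumrB -!natr_sum -!big_mkcond /= !sum1_card.
  rewrite !card_imset ?cAB ?subrr //;
  exact: val_inj.
have sval (x : {x : G | x \in C}) : s (val x) = (x \in A)%:R - (x \in B)%:R.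
  by rewrite /s !mem_imset //; exact: val_inj.
have AB (x : {x : G | x \in C}) : (x \in B) = (x \notin A).
  have : x \in A :|: B by rewrite ABT inE.
  rewrite inE; case: (boolP (x \in A)) => [xA _|//].
  exact: disjointFr ABdis xA.
have s_out x : x \notin C -> s x = 0.
  move=> xC; rewrite /s.
  have nin (D : {set {x : G | x \in C}}) : (x \in [set val z | z in D]) = false.
    by apply: contraNF xC => /imsetP[z _ ->]; exact: valP.
  by rewrite !nin subrr.
have s_in x : x \in C -> s x != 0.
  move=> xC; rewrite (sval (Sub x xC)) AB.
  by case: (_ \in A); rewrite ?subr0 ?sub0r ?oppr_eq0 oner_eq0.
have [eE _] := cut; have /edgesP[u [v [uv euv]]] := eE.
have : \sum_v (\sum_(f in edges G | v \in f) omega f) * s v = 0.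
  by rewrite -[RHS]sum_s; apply: eq_bigr => x _; rewrite flow mul1r.
(* Only the term of [e] survives; since one end of [e] is in [C], its factor [s u + s v] is 1 or
   -1. *)
rewrite flow_double_count (bigD1 e) //= [X in _ + X]big1 ?addr0.
  have uvC := cut_edge_component Gconn cut CC euv.
  rewrite euv (sum_edge _ uv) => /eqP; rewrite -euv mulf_eq0 => /orP[/eqP//|].
  case: (boolP (u \in C)) uvC => uC; case: (boolP (v \in C)) => vC //= _.
    by rewrite (s_out v vC) addr0 (negPf (s_in u uC)).
  by rewrite (s_out u uC) add0r (negPf (s_in v vC)).
move=> f /andP[/edgesP[x [y [xy ->]]] fe]; rewrite (sum_edge _ xy).
have xyC := component_adj CC xy fe.
case: (boolP (x \in C)) => xC; last first.
  by rewrite !s_out ?addr0 ?mulr0 // -xyC.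
have yC : y \in C by rewrite -xyC.
rewrite (sval (Sub x xC)) (sval (Sub y yC)) !AB.
have /(ABadj _ _) : @adj (@induced (del_edge e) C) (Sub x xC) (Sub y yC).
  by rewrite /= /induced_rel /= /del_rel xy.
by rewrite !AB => -[[-> /negPf->]|[/negPf-> ->]];
  rewrite subr0 sub0r ?subrr ?addNr mulr0.
Qed.

(** * Sufficiency: flows with a prescribed value on one edge *)

(** The Fredholm alternative for the vertex equations together with [omega e = c], whose dual
    variable is [l]. The unknowns range over all vertex sets; if [e] is not an edge, its dual
    equation reads [l = 0]. *)
Lemma prescribed_flow (R : fieldType) e (c : R) :
  (forall (s : G -> R) (l : R),
     (forall x y, adj x y -> s x + s y + l * ([set x; y] == e)%:R = 0) ->
     (e \notin edges G -> l = 0) -> \sum_x s x + c * l = 0) ->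
  exists omega : {set G} -> R,
    (forall v, \sum_(f in edges G | v \in f) omega f = 1) /\ omega e = c.
Proof.
move=> H.
pose a (f : {set G}) (j : G + 'I_1) : R :=
  if j is inl v then ((f \in edges G) && (v \in f))%:R else (f == e)%:R.
pose b (j : G + 'I_1) : R := if j is inl _ then 1 else c.
have [y ay0|omega omegaP] := @fredholm_alternative _ _ _ a b.
  pose s x := y (inl x); pose l := y (inr ord0).
  rewrite big_sumType /= big_ord1; under eq_bigr do rewrite mul1r.
  have row f : (f \in edges G)%:R * (\sum_(v in f) s v) + l * (f == e)%:R = 0.
    rewrite -[RHS](ay0 f) big_sumType /= big_ord1 mulrC [l * _]mulrC.
    congr (_ + _); rewrite big_mkcond big_distrl; apply: eq_bigr => v _ /=.
    by case: (f \in edges G) (v \in f) => [] [];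
      rewrite /= ?mulr1 ?mul1r ?mul0r ?mulr0.
  apply: H => [x z xz|/negPf enE].
    have /edgesP fE : exists x' z', adj x' z' /\ [set x; z] = [set x'; z'].
      by exists x, z.
    by rewrite -(sum_edge s xz) -[RHS](row [set x; z]) fE mul1r.
  by have := row e; rewrite enE mul0r add0r eqxx mulr1.
exists omega; split=> [v|].
  rewrite -[RHS](omegaP (inl v)) big_mkcond; apply: eq_bigr => f _ /=.
  by case: ifP; rewrite ?mulr1 ?mulr0.
rewrite -[RHS](omegaP (inr ord0)) (bigD1 e) //= eqxx mulr1 big1 ?addr0 //.
by move=> f /negPf->; rewrite mulr0.
Qed.

Section Bipartite.

Variables (R : numFieldType) (A B : {set G}).
Hypotheses (Gconn : graph_connected G) (AB : bipartition A B).
Hypothesis cAB : #|A| = #|B|.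

Let sgA x : R := (-1) ^+ (x \notin A).

Lemma in_otherside x : (x \in B) = (x \notin A).
Proof.
have [ABT ABdis _] := AB.
have : x \in A :|: B by rewrite ABT inE.
rewrite inE; case: (boolP (x \in A)) => [xA _|//].
exact: disjointFr ABdis xA.
Qed.

Lemma sgA_adj x y : adj x y -> sgA y = - sgA x.
Proof.
have [_ _ ABadj] := AB; move/ABadj; rewrite /sgA !in_otherside.
by move=> [[->]|[]] => [->|/negPf-> ->]; rewrite ?opprK.
Qed.

Lemma sum_sgA (C : {set G}) :
  \sum_(x in C) sgA x = #|C :&: A|%:R - #|C :&: B|%:R.
Proof.
rewrite -!sum1_card !natr_sum (big_setID A) /=; congr (_ + _).
  by apply: eq_bigr => x; rewrite inE /sgA => /andP[_ ->].
have -> : C :\: A = C :&: B by apply/setP => x; rewrite !inE in_otherside andbC.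
rewrite -sumrN; apply: eq_bigr => x; rewrite inE in_otherside /sgA.
by case/andP=> _ ->.
Qed.

Lemma sum_sgA0 : \sum_x sgA x = 0.
Proof.
have := sum_sgA [set: G]; rewrite !finset.setTI cAB subrr => sum0.
by rewrite -[RHS]sum0; apply: eq_bigl => x; rewrite inE.
Qed.

Lemma signed_weight_eq (s : G -> R) x y :
  adj x y -> (sgA x * s x == sgA y * s y) = (s x + s y == 0).
Proof.
move=> xy; rewrite (sgA_adj xy) mulNr -addr_eq0 -mulrDr.
by rewrite mulf_eq0 signr_eq0.
Qed.

(** Along an edge, [s x + s y = 0] says that [sgA * s] has the same value at both ends, so its level
    sets are closed under adjacency. *)
Lemma signed_weight_const (s : G -> R) e x y :
  (forall x y, adj x y -> [set x; y] != e -> s x + s y = 0) ->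
  connect (del_rel e) x y -> sgA x * s x = sgA y * s y.
Proof.
move=> s0; have clos z w : del_rel e z w ->
    (sgA z * s z == sgA x * s x) = (sgA w * s w == sgA x * s x).
  move=> /andP[zw zwe]; suff -> : sgA z * s z = sgA w * s w by [].
  by apply/eqP; rewrite signed_weight_eq // s0.
move=> /(closed_connect (a := [pred z | sgA z * s z == sgA x * s x]) clos).
by rewrite !inE eqxx => /esym/eqP.
Qed.

Lemma sum_signed (s : G -> R) : \sum_x s x = \sum_x sgA x * (sgA x * s x).
Proof.
by apply: eq_bigr => x _; rewrite mulrA -expr2 sqrr_sign mul1r.
Qed.

Lemma sum_weight_eq0 (s : G -> R) :
  (forall x y, adj x y -> s x + s y = 0) -> \sum_x s x = 0.
Proof.
(* The empty set is not an edge, so deleting it leaves [G] unchanged and [signed_weight_const]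
   applies to all of [G]. *)
move=> s0; have con x y : connect (del_rel finset.set0) x y.
  apply: connect_sub (graph_connectedP x y Gconn) => z w zw.
  apply: connect1; rewrite /del_rel zw; apply/eqP => /setP/(_ z).
  by rewrite !inE eqxx.
rewrite sum_signed; have [x _|G0] := pickP (@predT G); last first.
  by rewrite big1 // => x; have := G0 x.
under eq_bigr => y _.
  rewrite -(@signed_weight_const s finset.set0 x y) //;
    last by move=> *; exact: s0.
  over.
by rewrite -big_distrl /= sum_sgA0 mul0r.
Qed.

(** [sgA * s] equals [sgA v * s v] off the component of [u], and on it exceeds this by
    [sgA u * (s u + s v)], because [sgA v = - sgA u]. The constant part contributes nothing, as
    [sgA] sums to zero. *)
Lemma sum_weight_component (s : G -> R) u v :
  (forall x y, adj x y -> [set x; y] != [set u; v] -> s x + s y = 0) ->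
  adj u v ->
  \sum_x s x =
    sgA u * (s u + s v) * \sum_(x | connect (del_rel [set u; v]) u x) sgA x.
Proof.
move=> s0 uv; rewrite sum_signed.
have sE x : sgA x * s x = sgA v * s v +
    sgA u * (s u + s v) * (connect (del_rel [set u; v]) u x)%:R.
  have sgA_uv := sgA_adj uv.
  case: (boolP (connect _ u x)) => [ux|nux].
    by rewrite -(signed_weight_const s0 ux) sgA_uv mulr1; ring.
  rewrite mulr0 addr0; apply/esym/(signed_weight_const s0).
  by case: (connect_del_edge v (graph_connectedP u x Gconn)) nux => // ->.
under eq_bigr do rewrite sE mulrDr.
rewrite big_split -big_distrl /= sum_sgA0 mul0r add0r.
rewrite [in RHS]big_mkcond big_distrr; apply: eq_bigr => x _ /=.
by case: ifP; rewrite ?mulr1 ?mulr0 // mulrC.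
Qed.

(** The signed sum over [C] is the difference of the sizes of its two parts, and characteristic zero
    turns its vanishing into equality of these sizes. *)
Lemma component_balanced e (C : {set G}) :
  \sum_(x in C) sgA x = 0 -> balanced_bipartite (@induced (del_edge e) C).
Proof.
rewrite sum_sgA => /eqP; rewrite subr_eq0 eqr_nat => /eqP CAB.
exists [set x | val x \in A], [set x | val x \in B]; split.
  have [ABT ABdis ABadj] := AB; split.
  - by apply/setP => x; rewrite !inE in_otherside orbN.
  - rewrite -setI_eq0; apply/eqP/setP => x.
    by rewrite !inE in_otherside andbN.
  - by move=> x y /andP[/ABadj]; rewrite !inE.
have cardC (D : {set G}) :
    #|[set x : {x | x \in C} | val x \in D]| = #|C :&: D|.
  rewrite -(card_imset _ val_inj); apply: eq_card => x; rewrite inE.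
  apply/imsetP/andP => [[z]|[xC xD]].
    by rewrite inE => zD ->; split=> //; exact: valP.
  by exists (Sub x xC); rewrite ?inE.
by rewrite !cardC.
Qed.

Lemma flow_through e :
  (forall e, cut_edge e -> forall C, C \in components (del_edge e) ->
     ~ balanced_bipartite (@induced (del_edge e) C)) ->
  exists2 omega : {set G} -> R,
    forall v, \sum_(f in edges G | v \in f) omega f = 1 & omega e != 0.
Proof.
move=> unbal.
suff [c c0 cP] : exists2 c : R, c != 0 & forall (s : G -> R) (l : R),
     (forall x y, adj x y -> s x + s y + l * ([set x; y] == e)%:R = 0) ->
     (e \notin edges G -> l = 0) -> \sum_x s x + c * l = 0.
  by have [omega [flow omegae]] := prescribed_flow cP;
    exists omega; rewrite ?omegae.
have [/edgesP[u [v [uv ->]]]|enE] := boolP (e \in edges G); last first.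
  exists 1 => [|s l s0 /(_ isT) l0]; first exact: oner_neq0.
  rewrite l0 mulr0 addr0; apply: sum_weight_eq0 => x y xy.
  by have := s0 x y xy; rewrite l0 mul0r addr0.
set e' := [set u; v].
have s0' (s : G -> R) l :
    (forall x y, adj x y -> s x + s y + l * ([set x; y] == e')%:R = 0) ->
    (forall x y, adj x y -> [set x; y] != e' -> s x + s y = 0) /\
    s u + s v = - l.
  move=> s0; split=> [x y xy /negPf xye|].
    by have := s0 x y xy; rewrite xye mulr0 addr0.
  by have := s0 u v uv; rewrite eqxx mulr1 => /eqP; rewrite addr_eq0 => /eqP.
(* If [u] and [v] stay connected, the signed weight agrees at both, so [s u + s v], [l] and the
   total weight all vanish and any [c] works. *)
have [cuv|ncuv] := boolP (connect (del_rel e') u v).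
  exists 1 => [|s l /s0'[s0 suv] _]; first exact: oner_neq0.
  have /eqP := signed_weight_const s0 cuv.
  rewrite signed_weight_eq // => /eqP uv0.
  rewrite (sum_weight_component s0 uv) uv0 mulr0 mul0r add0r mul1r.
  by apply/eqP; rewrite -oppr_eq0 -suv uv0.
pose C := [set x | connect (del_rel e') u x].
(* The imbalance of the component of [u], up to sign: as [s u + s v = - l], the total weight is
   exactly [- c * l]. Were [c] zero, [C] would be balanced. *)
exists (sgA u * \sum_(x in C) sgA x).
  rewrite mulf_eq0 signr_eq0 /=; apply/eqP => /(@component_balanced e').
  apply: unbal; first exact: cut_edge_separated ncuv.
  by apply/mem_component; exists u.
move=> s l /s0'[s0 suv] _; rewrite (sum_weight_component s0 uv) suv.
have -> : \sum_(x in C) sgA x = \sum_(x | connect (del_rel e') u x) sgA x.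
  by apply: eq_bigl => x; rewrite inE.
by ring.
Qed.

End Bipartite.

End Graph.

Theorem theorem6 (R : realType) (G : sgraph)
    (Gconn : graph_connected G) (Gbal : balanced_bipartite G) :
  (exists omega : {set G} -> R, one_sum_flow (@nonzero_reals R) omega) <->
  (forall e : {set G}, cut_edge e ->
     forall C : {set G}, C \in components (del_edge e) ->
       ~ balanced_bipartite (@induced (del_edge e) C)).
Proof.
split=> [[omega [nz flow]] e cut C CC Cbal|unbal].
  have := nz e (proj1 cut).
  by rewrite /nonzero_reals /= (flow_not_balanced Gconn flow cut CC Cbal) eqxx.
have [A [B [AB cAB]]] := Gbal.
have through e := flow_through R Gconn AB cAB e unbal.
pose is_flow (omega : {set G} -> R) :=
  forall v : G, \sum_(f in edges G | v \in f) omega f = 1.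
(* [flow_through] handles every vertex set, edge or not, so the list can enumerate all of them;
   flows are closed under affine combinations. *)
have [|||omega flow nz] :=
    @generic_affine_combination R {set G} (enum {set G}) is_flow.
- move=> t f g ff fg v; rewrite big_split /= -big_distrr /= sumrB.
  by rewrite ff fg subrr mulr0 addr0.
- by have [omega] := through finset.set0; exists omega.
- by move=> e _; exact: through.
exists omega; split=> // e _; rewrite /nonzero_reals /=.
by apply: nz; rewrite mem_enum.
Qed.
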